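(* Let $\mathsf P$ be a finite poset, $(\mathcal X,\nu)$ a $\mathsf P$-graded cell complex over a field $\mathbb K$, $(C(\mathcal X),\pi^\nu)$ the associated $\mathsf P$-graded chain complex, and $\mathscr G=\mathfrak H(\mathcal B(\mathcal X,\nu))$ the associated graded module braid over $\mathsf P$. If $(C',\pi)$ is a Conley complex for $(C(\mathcal X),\pi^\nu)$ with boundary operator $\partial'$, then $\partial'$ is a connection matrix in the sense of Franzosa for $\mathscr G$; that is, $\partial'^{pp}=0$ for all $p\in\mathsf P$ and there is an isomorphism of graded module braids $\mathfrak H\circ\mathfrak B(C',\pi)\cong\mathscr G$.
   Context: Vector spaces are finite-dimensional over $\mathbb K$. Cell complex: a finite poset $(\mathcal X,\leq)$ with an order-preserving $\dim\colon\mathcal X\to\mathbb N$ and $\kappa\colon\mathcal X\times\mathcal X\to\mathbb K$ such that $\kappa(\xi,\xi')\neq0$ implies $\xi'\leq\xi$ and $\dim\xi=\dim\xi'+1$, and $\sum_{\xi'}\kappa(\xi,\xi')\kappa(\xi',\xi'')=0$. $C_n(\mathcal X)$ has basis the $n$-dimensional cells, $\partial\xi=\sum\kappa(\xi,\xi')\xi'$. A $\mathsf P$-graded cell complex is a cell complex with an order-preserving $\nu\colon(\mathcal X,\leq)\to\mathsf P$; $\pi^\nu$ consists of the projections $C_j(\mathcal X)\to C_j(\nu^{-1}(p))$. A $\mathsf P$-graded vector space is $V$ with idempotents $\pi^p$, $\sum_p\pi^p=\mathrm{id}$, $\pi^p\pi^q=0$ ($p\neq q$); $V^p=\operatorname{im}\pi^p$.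 A linear map is $\mathsf P$-filtered if $\phi^{pq}:=\pi^p\phi\pi^q\neq0$ implies $p\leq q$. A $\mathsf P$-graded chain complex is a $\mathbb Z$-indexed chain complex of $\mathsf P$-graded vector spaces with $\mathsf P$-filtered boundary maps. A Conley complex for $(C,\pi)$ is a $\mathsf P$-graded chain complex $(C',\pi)$ that is strict ($\partial'^{pp}_j=0$ for all $p,j$) and $\mathsf P$-filtered chain equivalent to $(C,\pi)$ ($\mathsf P$-filtered chain maps both ways, inverse up to $\mathsf P$-filtered chain homotopies). $I(\mathsf P)$ is the set of convex subsets of $\mathsf P$ ($p,q\in I$, $p\leq x\leq q$ imply $x\in I$). An ordered collection $(I_1,\dots,I_n)$ of convex sets is adjacent if they are mutually disjoint, their union is convex, and $p\in I_i,q\in I_j,i<j$ imply $q\nless p$. $I_2(\mathsf P),I_3(\mathsf P)$ are the sets of adjacent pairs and triples; $IJ=I\cup J$. $I,J$ are incomparable if every $p\in I$, $q\in J$ are incomparable. A chain complex braid $\mathscr C$ over $\mathsf P$ assigns to each $I\in I(\mathsf P)$ a chain complex $C(I)$ and to each $(I,J)\in I_2(\mathsf P)$ chain maps $i(I,IJ)\colon C(I)\to C(IJ)$, $p(IJ,J)\colon C(IJ)\to C(J)$ such that: (a) $i$ is injective, $p\circ i=0$, and $C(IJ)/\operatorname{im}i\to C(J)$ induces an isomorphism on homology; (b) $p(JI,I)i(I,IJ)=\mathrm{id}$ if $I,J$ are incomparable; (c) for $(I,J,K)\in I_3(\mathsf P)$ the diagram formed by $C(I),C(J),C(K),C(IJ),C(JK),C(IJK)$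 commutes, i.e. $i(IJ,IJK)i(I,IJ)=i(I,IJK)$, $p(JK,K)p(IJK,JK)=p(IJK,K)$, $i(J,JK)p(IJ,J)=p(IJK,JK)i(IJ,IJK)$. A graded module braid over $\mathsf P$ (over $\mathbb K$) assigns to each $I\in I(\mathsf P)$ a graded vector space $G(I)$ and to each $(I,J)\in I_2(\mathsf P)$ maps $i(I,IJ)\colon G(I)\to G(IJ)$, $p(IJ,J)\colon G(IJ)\to G(J)$ of degree $0$ and $\partial(J,I)\colon G(J)\to G(I)$ of degree $-1$ such that: (a) $\cdots\to G(I)\xrightarrow{i}G(IJ)\xrightarrow{p}G(J)\xrightarrow{\partial}G(I)\to\cdots$ is exact; (b) $p(JI,I)i(I,IJ)=\mathrm{id}$ if $I,J$ are incomparable; (c) for $(I,J,K)\in I_3(\mathsf P)$ the braid diagram formed by the four long exact sequences of $(I,J)$, $(J,K)$, $(I,JK)$, $(IJ,K)$ commutes, i.e. the three relations of (c) above hold together with $p(IJ,J)\partial(K,IJ)=\partial(K,J)$, $\partial(JK,I)i(J,JK)=\partial(J,I)$ and $\partial(K,IJ)p(JK,K)=i(I,IJ)\partial(JK,I)$. A morphism of graded module braids is a family of degree-$0$ maps $\Theta(I)\colon G(I)\to G'(I)$, $I\in I(\mathsf P)$, commuting with all $i,p,\partial$. $\mathfrak H$ sends a chain complex braid $\mathscr C$ to the graded module braid with $G(I)=H_\bullet(C(I))$, $i,p$ the induced maps, and $\partial(J,I)[x]=[i^{-1}\partial p^{-1}x]$ the connecting homomorphism. For a $\mathsf P$-graded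 chain complex $(C,\pi)$, $\mathfrak B(C,\pi)$ is the chain complex braid with $C(I)=C^I=\bigoplus_{p\in I}C^p$, boundary $\Delta^I=e^I\partial\iota^I$ ($\iota^I\colon C^I\to C$ inclusion, $e^I\colon C\to C^I$ projection), and the natural inclusions and projections. $\mathcal B(\mathcal X,\nu)=\mathfrak B(C(\mathcal X),\pi^\nu)$. Franzosa's definition: for a $\mathsf P$-graded chain complex $(C,\pi)$ its boundary operator $\partial$ is a connection matrix for a graded module braid $\mathscr G$ if $\mathfrak H\circ\mathfrak B(C,\pi)\cong\mathscr G$ as graded module braids and $\partial^{pp}=0$ for all $p\in\mathsf P$. *)

(* Defs.v *)
From HB Require Import structures.
From mathcomp Require Import all_boot order ssralg ssrint zmodp matrix vector ring_quotient.

Set Implicit Arguments.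
Unset Strict Implicit.
Unset Printing Implicit Defensive.

Import Order.TTheory GRing.Theory.
Local Open Scope ring_scope.
Local Open Scope lfun_scope.

Section QuotientSpace.
Variables (K : fieldType) (V : vectType K) (U : {vspace V}).

(* The set of cosets v + U; the zmodType structure is that of ring_quotient. *)
Definition quotv : Type := @Quotient.quot V U.
HB.instance Definition _ := GRing.Zmodule.on quotv.

Local Open Scope quotient_scope.

Definition quotv_class (v : V) : quotv := \pi_(@Quotient.quot V U) v.
Definition quotv_repr (a : quotv) : V := repr (a : @Quotient.quot V U).

Lemma quotv_reprK : cancel quotv_repr quotv_class.
Proof. by move=> a; exact: reprK. Qed.

Lemma quotv_classE u v : (quotv_class u == quotv_class v) = (u - v \in U).
Proof. by rewrite Quotient.idealrBE. Qed.

Lemma quotv_class_reprB v : quotv_repr (quotv_class v) - v \in U.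
Proof. by rewrite -quotv_classE quotv_reprK. Qed.

Lemma quotv_classB : {morph quotv_class : u v / u - v}.
Proof. by move=> u v; rewrite /quotv_class raddfB. Qed.

Lemma quotv_classD : {morph quotv_class : u v / u + v}.
Proof. by move=> u v; rewrite /quotv_class raddfD. Qed.

Definition quotv_scale (k : K) (a : quotv) : quotv :=
  quotv_class (k *: quotv_repr a).

Lemma quotv_scale_class k v :
  quotv_scale k (quotv_class v) = quotv_class (k *: v).
Proof.
by apply/eqP; rewrite quotv_classE -scalerBr memvZ ?quotv_class_reprB.
Qed.

Lemma quotv_scaleA k l a : quotv_scale k (quotv_scale l a) =
  quotv_scale (k * l) a.
Proof. by rewrite -(quotv_reprK a) !quotv_scale_class scalerA. Qed.

Lemma quotv_scale1 : left_id 1 quotv_scale.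
Proof. by move=> a; rewrite -(quotv_reprK a) quotv_scale_class scale1r. Qed.

Lemma quotv_scaleDr : right_distributive quotv_scale +%R.
Proof.
move=> k a b; rewrite -(quotv_reprK a) -(quotv_reprK b).
by rewrite -quotv_classD !quotv_scale_class scalerDr quotv_classD.
Qed.

Lemma quotv_scaleDl a : {morph quotv_scale^~ a : k l / k + l}.
Proof.
move=> k l; rewrite -(quotv_reprK a) !quotv_scale_class -quotv_classD.
by rewrite -scalerDl.
Qed.

HB.instance Definition _ := GRing.Zmodule_isLmodule.Build K quotv
  quotv_scaleA quotv_scale1 quotv_scaleDr quotv_scaleDl.

Lemma quotv_class_is_linear : linear quotv_class.
Proof. by move=> k u v; rewrite quotv_classD -quotv_scale_class. Qed.

HB.instance Definition _ := GRing.isLinear.Build K V quotv _ quotv_class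
  quotv_class_is_linear.

Lemma quotv_class_eq0 v : (quotv_class v == 0) = (v \in U).
Proof. by rewrite -[0](raddf0 quotv_class) quotv_classE subr0. Qed.

Definition quotv_proj (v : V) : V := daddv_pi (U^C)%VS U v.

Lemma quotv_capCv : (U^C :&: U = 0)%VS.
Proof. by rewrite capvC capv_compl. Qed.

Lemma quotv_projB v : v - quotv_proj v \in U.
Proof.
have vS : v \in (U^C + U)%VS by rewrite addvC addv_complf memvf.
by rewrite -{1}(daddv_pi_add quotv_capCv vS) addrC addKr memv_pi.
Qed.

Lemma quotv_proj_id v : v \in (U^C)%VS -> quotv_proj v = v.
Proof. exact: daddv_pi_id quotv_capCv. Qed.

Lemma quotv_proj_repr v : quotv_proj (quotv_repr (quotv_class v)) = quotv_proj v.
Proof.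
apply/eqP; rewrite -subr_eq0 /quotv_proj -linearB /= -memv0 -quotv_capCv.
rewrite memv_cap memv_pi /=; set w := _ - _.
rewrite -[X in X \in U](subKr w); apply: rpredB; first exact: quotv_class_reprB.
exact: quotv_projB.
Qed.

Definition quotv_coord (a : quotv) : 'rV[K]_(\dim (U^C)) :=
  \row_i coord (vbasis (U^C)%VS) i (quotv_proj (quotv_repr a)).

Lemma quotv_coord_class v : quotv_coord (quotv_class v) =
  \row_i coord (vbasis (U^C)%VS) i (quotv_proj v).
Proof. by rewrite /quotv_coord quotv_proj_repr. Qed.

Lemma quotv_vect_axiom : Vector.axiom (\dim (U^C)) quotv.
Proof.
exists quotv_coord.
  move=> k a b; rewrite -(quotv_reprK a) -(quotv_reprK b) -linearP.
  by apply/rowP => i; rewrite !quotv_coord_class /quotv_proj !mxE !linearP.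
pose comb (r : 'rV[K]_(\dim (U^C))) := \sum_i r 0 i *: (vbasis (U^C)%VS)`_i.
have combU r : comb r \in (U^C)%VS.
  by apply: rpred_sum => j _; rewrite rpredZ ?vbasis_mem ?memt_nth.
exists (fun r => quotv_class (comb r)).
  move=> a; rewrite -[RHS]quotv_reprK; apply/eqP; rewrite quotv_classE.
  have -> : comb (quotv_coord a) = quotv_proj (quotv_repr a).
    rewrite [RHS](coord_vbasis (memv_pi _ _ _)).
    by apply: eq_bigr => i _; rewrite mxE.
  by rewrite -opprB rpredN quotv_projB.
move=> r; rewrite quotv_coord_class quotv_proj_id //; apply/rowP => i.
by rewrite mxE coord_sum_free ?(basis_free (vbasisP _)).
Qed.

HB.instance Definition _ := Lmodule_hasFinDim.Build K quotv quotv_vect_axiom.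

Definition quotmap : 'Hom(V, quotv) := linfun quotv_class.

Lemma quotmapE v : quotmap v = quotv_class v.
Proof. by rewrite lfunE. Qed.

Lemma quotmap_eq0 v : (quotmap v == 0) = (v \in U).
Proof. by rewrite quotmapE quotv_class_eq0. Qed.

Lemma quotmap_surj a : exists v, quotmap v = a.
Proof. by exists (quotv_repr a); rewrite quotmapE quotv_reprK. Qed.

Lemma quotmapVK : cancel quotmap^-1 quotmap.
Proof.
move=> a; apply: limg_lfunVK.
by case: (quotmap_surj a) => v <-; rewrite memv_img ?memvf.
Qed.

Lemma quotmapKV v : quotmap^-1%VF (quotmap v) - v \in U.
Proof. by rewrite -quotmap_eq0 linearB /= quotmapVK subrr. Qed.

End QuotientSpace.

Definition quot_lfun (K : fieldType) (V W : vectType K)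
    (U : {vspace V}) (U' : {vspace W}) (f : 'Hom(V, W)) :
    'Hom(quotv U, quotv U') :=
  quotmap U' \o f \o (quotmap U)^-1.

Lemma quot_lfunE (K : fieldType) (V W : vectType K)
    (U : {vspace V}) (U' : {vspace W}) (f : 'Hom(V, W)) v :
  (f @: U <= U')%VS -> quot_lfun U U' f (quotmap U v) = quotmap U' (f v).
Proof.
move=> fU; rewrite /quot_lfun !comp_lfunE; apply/eqP.
rewrite -subr_eq0 -!linearB /= quotmap_eq0.
by apply: (subvP fU); rewrite memv_img ?quotmapKV.
Qed.

Section Subspace.
Variables (K : fieldType) (V : vectType K) (W : {vspace V}).

Definition subv_incl : 'Hom(subvs_of W, V) := linfun vsval.
Definition subv_proj : 'Hom(V, subvs_of W) := linfun (vsproj W).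

Lemma subv_inclE w : subv_incl w = vsval w. Proof. exact: lfunE. Qed.
Lemma subv_projE v : subv_proj v = vsproj W v. Proof. exact: lfunE. Qed.

Lemma subv_inclP w : subv_incl w \in W.
Proof. by rewrite subv_inclE subvsP. Qed.

Lemma subv_inclK : cancel subv_incl subv_proj.
Proof. by move=> w; rewrite subv_inclE subv_projE vsvalK. Qed.

Lemma subv_projK v : v \in W -> subv_incl (subv_proj v) = v.
Proof. by move=> vW; rewrite subv_inclE subv_projE vsprojK. Qed.

Lemma subv_incl_inj : injective subv_incl.
Proof. exact: can_inj subv_inclK. Qed.

End Subspace.

(* The boundary is a two-index family bd i j : C_i -> C_j that vanishes     *)
(* unless i = j + 1, so that no transport along j + 1 - 1 = j is needed.    *)
Record chain_complex (K : fieldType) := ChainComplex {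
  cc_space :> int -> vectType K;
  bd : forall i j : int, 'Hom(cc_space i, cc_space j);
  bd_shape : forall i j, i != j + 1 -> bd i j = 0;
  bd_bd : forall i j k, bd j k \o bd i j = 0 }.

Record chain_map (K : fieldType) (C D : chain_complex K) := ChainMap {
  cm_fun :> forall n : int, 'Hom(C n, D n);
  cm_bd : forall i j, cm_fun j \o bd C i j = bd D i j \o cm_fun i }.

Section ChainComplexTheory.
Variables (K : fieldType) (C D : chain_complex K) (f : chain_map C D).

Lemma bd_bdE i j k x : bd C j k (bd C i j x) = 0.
Proof. by rewrite -comp_lfunE bd_bd zero_lfunE. Qed.

Lemma cm_bdE i j x : f j (bd C i j x) = bd D i j (f i x).
Proof. by rewrite -!comp_lfunE cm_bd. Qed.

End ChainComplexTheory.

Section Homology.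
Variables (K : fieldType) (C : chain_complex K) (n : int).

Definition cycles : {vspace C n} := lker (bd C n (n - 1)).
Definition boundaries : {vspace C n} := limg (bd C (n + 1) n).

(* The boundaries, as a subspace of the space of cycles. *)
Definition cycle_boundaries : {vspace subvs_of cycles} :=
  (subv_incl cycles @^-1: boundaries)%VS.

Definition homology : vectType K := quotv cycle_boundaries.

(* The class [x] of a cycle x (junk outside cycles). *)
Definition hclass : 'Hom(C n, homology) :=
  quotmap cycle_boundaries \o subv_proj cycles.

(* A linear choice of representing cycles. *)
Definition hrep : 'Hom(homology, C n) :=
  subv_incl cycles \o (quotmap cycle_boundaries)^-1.

Lemma hrepK : cancel hrep hclass.
Proof.
by move=> a; rewrite /hclass /hrep !comp_lfunE subv_inclK quotmapVK.
Qed.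

Lemma hrep_cycle a : hrep a \in cycles.
Proof. by rewrite /hrep comp_lfunE subv_inclP. Qed.

Lemma cycle_bd m x : x \in cycles -> bd C n m x = 0.
Proof.
rewrite memv_ker => /eqP x0; have [->|nm] := eqVneq m (n - 1); first by [].
by rewrite bd_shape ?zero_lfunE //; apply: contra nm => /eqP->; rewrite addrK.
Qed.

Lemma bd_cycle x : bd C n (n - 1) x = 0 -> x \in cycles.
Proof. by move=> x0; rewrite memv_ker x0. Qed.

Lemma hclass_eq0 x : x \in cycles -> (hclass x == 0) = (x \in boundaries).
Proof.
move=> xZ; rewrite /hclass comp_lfunE quotmap_eq0 -memv_preim.
by rewrite subv_projK.
Qed.

Lemma hclass_bd m x : hclass (bd C m n x) = 0.
Proof.
apply/eqP; rewrite hclass_eq0; last by apply: bd_cycle; rewrite bd_bdE.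
case: (eqVneq m (n + 1)) x => [-> x|mn x]; first by rewrite memv_img ?memvf.
by rewrite bd_shape // zero_lfunE mem0v.
Qed.

Lemma hclass0P m x : m = n + 1 -> x \in cycles -> hclass x = 0 ->
  exists w : C m, bd C m n w = x.
Proof.
move=> -> xZ /eqP; rewrite hclass_eq0 // => /memv_imgP[w _ ->].
by exists w.
Qed.

Lemma hclass_surj a : exists2 x, x \in cycles & a = hclass x.
Proof. by exists (hrep a); rewrite ?hrep_cycle ?hrepK. Qed.

End Homology.

Definition Hmap (K : fieldType) (C D : chain_complex K) (f : chain_map C D)
    (n : int) : 'Hom(homology C n, homology D n) :=
  hclass D n \o f n \o hrep C n.

Section HmapTheory.
Variables (K : fieldType) (C D : chain_complex K).

Lemma cm_cycle (f : chain_map C D) n x : x \in cycles C n -> f n x \in cycles D n.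
Proof. by move=> xZ; apply: bd_cycle; rewrite -cm_bdE cycle_bd ?linear0. Qed.

Lemma hclass_eq n x y : x \in cycles C n -> y \in cycles C n ->
  hclass C n x = hclass C n y -> exists w, x = y + bd C (n + 1) n w.
Proof.
move=> xZ yZ /eqP; rewrite -subr_eq0 -linearB => /eqP xy0.
have [w wE] := hclass0P (erefl (n + 1)) (rpredB xZ yZ) xy0.
by exists w; rewrite wE addrC subrK.
Qed.

Lemma HmapE (f : chain_map C D) n x : x \in cycles C n ->
  Hmap f n (hclass C n x) = hclass D n (f n x).
Proof.
move=> xZ; rewrite /Hmap 2!comp_lfunE.
have [w ->] := hclass_eq (hrep_cycle _) xZ (hrepK (hclass C n x)).
by rewrite !linearD /= cm_bdE hclass_bd addr0.
Qed.

Definition quasi_iso (f : chain_map C D) : Prop :=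
  forall n, bijective (Hmap f n).

Lemma bij_quasi_iso (f : chain_map C D) :
  (forall n, bijective (f n)) -> quasi_iso f.
Proof.
move=> fbij n.
have inj : injective (Hmap f n).
  suff H0 a : Hmap f n a = 0 -> a = 0.
    move=> a b /eqP; rewrite -subr_eq0 -linearB => /eqP/H0/eqP.
    by rewrite subr_eq0 => /eqP.
  have [x xZ ->] := hclass_surj a; rewrite HmapE // => /hclass0P.
  move=> /(_ _ (erefl _) (cm_cycle f xZ))[w wE].
  have [g _ gK] := fbij (n + 1); rewrite -(gK w) -cm_bdE in wE.
  by rewrite -(bij_inj (fbij n) wE) hclass_bd.
have sur a : exists b, Hmap f n b = a.
  have [y yZ ->] := hclass_surj a; have [g _ gK] := fbij n.
  have gZ : g y \in cycles C n.
    apply: bd_cycle; apply: (bij_inj (fbij _)).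
    by rewrite cm_bdE gK linear0 cycle_bd.
  by exists (hclass C n (g y)); rewrite HmapE // gK.
have ker0 : lker (Hmap f n) == 0%VS by apply/lker0P.
exists (Hmap f n)^-1; first exact: lker0_lfunK.
move=> a; apply: limg_lfunVK; have [b <-] := sur a.
by rewrite memv_img ?memvf.
Qed.

Lemma quasi_isoK (f : chain_map C D) n : quasi_iso f ->
  cancel (Hmap f n)^-1 (Hmap f n).
Proof.
move=> fq a; apply: limg_lfunVK; have [g _ gK] := fq n.
by rewrite -(gK a) memv_img ?memvf.
Qed.

End HmapTheory.

Section QuotientComplex.
Variables (K : fieldType) (A B : chain_complex K) (i : chain_map A B).

Definition quotc_space (n : int) : vectType K := quotv (limg (i n)).
Definition quotc_bd (m n : int) : 'Hom(quotc_space m, quotc_space n) :=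
  quot_lfun (limg (i m)) (limg (i n)) (bd B m n).

Lemma quotc_bdE m n x :
  quotc_bd m n (quotmap (limg (i m)) x) = quotmap (limg (i n)) (bd B m n x).
Proof.
apply: quot_lfunE; apply/subvP => _ /memv_imgP[_ /memv_imgP[a _ ->] ->].
by rewrite -cm_bdE memv_img ?memvf.
Qed.

Lemma quotc_bd_shape m n : m != n + 1 -> quotc_bd m n = 0.
Proof.
move=> mn; apply/lfunP => a; have [x <-] := quotmap_surj a.
by rewrite quotc_bdE bd_shape // !zero_lfunE linear0.
Qed.

Lemma quotc_bd_bd l m n : quotc_bd m n \o quotc_bd l m = 0.
Proof.
apply/lfunP => a; have [x <-] := quotmap_surj a.
by rewrite comp_lfunE !quotc_bdE bd_bdE linear0 zero_lfunE.
Qed.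

Definition quotc : chain_complex K := ChainComplex quotc_bd_shape quotc_bd_bd.

Variables (C : chain_complex K) (p : chain_map B C).
Hypothesis pi0 : forall n, p n \o i n = 0.

Lemma quotc_pi0E n x : p n (i n x) = 0.
Proof. by rewrite -comp_lfunE pi0 zero_lfunE. Qed.

Definition quotc_lift_fun (n : int) : 'Hom(quotc n, C n) :=
  p n \o (quotmap (limg (i n)))^-1.

Lemma quotc_lift_funE n x : quotc_lift_fun n (quotmap (limg (i n)) x) = p n x.
Proof.
rewrite /quotc_lift_fun comp_lfunE; apply/eqP; rewrite -subr_eq0 -linearB /=.
have /memv_imgP[a _ ->] := quotmapKV (limg (i n)) x.
by rewrite quotc_pi0E.
Qed.

Lemma quotc_lift_bd m n :
  quotc_lift_fun n \o bd quotc m n = bd C m n \o quotc_lift_fun m.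
Proof.
apply/lfunP => a; have [x <-] := quotmap_surj a.
by rewrite 2!comp_lfunE quotc_bdE !quotc_lift_funE cm_bdE.
Qed.

Definition quotc_lift : chain_map quotc C := ChainMap quotc_lift_bd.

(* [x] |-> [i^-1 bd p^-1 x]. As p is only required to induce an isomorphism *)
(* H(B / im i) -> H(C), the preimage of [x] is first taken in H(B / im i),  *)
(* then lifted to B along the projection B -> B / im i.                     *)
Definition connecting (n : int) : 'Hom(homology C n, homology A (n - 1)) :=
  hclass A (n - 1) \o (i (n - 1))^-1 \o bd B n (n - 1)
    \o (quotmap (limg (i n)))^-1 \o hrep quotc n \o (Hmap quotc_lift n)^-1.

Hypothesis i_inj : forall n, injective (i n).
Hypothesis p_qis : quasi_iso quotc_lift.

Lemma inj_lfunK n : cancel (i n) (i n)^-1.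
Proof. by apply: lker0_lfunK; apply/lker0P. Qed.

Lemma quotc_cycle n y z : i (n - 1) z = bd B n (n - 1) y ->
  quotmap (limg (i n)) y \in cycles quotc n.
Proof.
move=> zE; apply: bd_cycle; apply/eqP; rewrite quotc_bdE quotmap_eq0 -zE.
by rewrite memv_img ?memvf.
Qed.

Lemma connecting_cycle n y z : i (n - 1) z = bd B n (n - 1) y ->
  (z \in cycles A (n - 1)) * (p n y \in cycles C n).
Proof.
move=> zE; split; apply: bd_cycle.
  by apply: i_inj; rewrite cm_bdE zE bd_bdE linear0.
by rewrite -cm_bdE -zE quotc_pi0E.
Qed.

Lemma connectingE n y z : i (n - 1) z = bd B n (n - 1) y ->
  connecting n (hclass C n (p n y)) = hclass A (n - 1) z.
Proof.
move=> zE; have yZ := quotc_cycle zE; rewrite /connecting 5!comp_lfunE.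
rewrite -quotc_lift_funE -(HmapE quotc_lift yZ).
have -> : (Hmap quotc_lift n)^-1 (Hmap quotc_lift n (hclass quotc n
    (quotmap (limg (i n)) y))) = hclass quotc n (quotmap (limg (i n)) y).
  by apply: lker0_lfunK; apply/lker0P; apply: bij_inj (p_qis n).
set a := hrep _ _ _.
have [w wE] := hclass_eq (hrep_cycle _) yZ (hrepK (hclass quotc n
    (quotmap (limg (i n)) y))).
have [w' w'E] := quotmap_surj w; rewrite -/a -w'E quotc_bdE in wE.
rewrite wE -linearD.
have := quotmapKV (limg (i n)) (y + bd B (n + 1) n w').
set u := _^-1 _; move=> /memv_imgP[x _ uE].
have -> : u = i n x + (y + bd B (n + 1) n w') by rewrite -uE subrK.
rewrite !linearD /= bd_bdE !linear0 addr0 -zE -cm_bdE !inj_lfunK.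
by rewrite hclass_bd add0r.
Qed.

Lemma connecting_surj n a : exists y, exists2 z,
  i (n - 1) z = bd B n (n - 1) y & a = hclass C n (p n y).
Proof.
have [g _ gK] := p_qis n; have [b bZ gE] := hclass_surj (g a).
have [y yE] := quotmap_surj b; exists y.
have /memv_imgP[z _ zE] : bd B n (n - 1) y \in limg (i (n - 1)).
  by rewrite -quotmap_eq0 -quotc_bdE yE; apply/eqP/(cycle_bd _ bZ).
exists z => //; rewrite -quotc_lift_funE yE -(HmapE quotc_lift bZ).
by rewrite -gE gK.
Qed.

Lemma exact_mid n : (limg (Hmap i n) = lker (Hmap p n))%VS.
Proof.
apply/vspaceP => a; rewrite memv_ker; apply/idP/idP.
  case/memv_imgP => b _ ->; have [x xZ ->] := hclass_surj b.
  by rewrite !HmapE ?cm_cycle // quotc_pi0E linear0.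
have [y yZ ->] := hclass_surj a; rewrite HmapE // => /eqP py0.
have qZ : quotmap (limg (i n)) y \in cycles quotc n.
  by apply: bd_cycle; rewrite quotc_bdE cycle_bd ?linear0.
have q0 : hclass quotc n (quotmap (limg (i n)) y) = 0.
  apply: (bij_inj (p_qis n)).
  by rewrite HmapE //= quotc_lift_funE py0 linear0.
have [w wE] := hclass0P (erefl _) qZ q0; have [w' w'E] := quotmap_surj w.
move: wE; rewrite -w'E quotc_bdE => /eqP; rewrite eq_sym -subr_eq0 -linearB.
rewrite quotmap_eq0 => /memv_imgP[x _ xE].
have xZ : x \in cycles A n.
  apply: bd_cycle; apply: i_inj.
  by rewrite cm_bdE -xE linearB /= bd_bdE subr0 cycle_bd ?linear0.
have -> : hclass B n y = Hmap i n (hclass A n x).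
  by rewrite HmapE // -xE linearB /= hclass_bd subr0.
by rewrite memv_img ?memvf.
Qed.

Lemma exact_right n : (limg (Hmap p n) = lker (connecting n))%VS.
Proof.
apply/vspaceP => a; rewrite memv_ker; apply/idP/idP.
  case/memv_imgP => b _ ->; have [y yZ ->] := hclass_surj b.
  rewrite HmapE // (@connectingE n y 0) ?linear0 //.
  by rewrite cycle_bd.
have [y [z zE ->]] := connecting_surj a; rewrite (connectingE zE) => /eqP z0.
have [zZ _] := connecting_cycle zE.
have [w wE] := hclass0P (esym (subrK 1 n)) zZ z0.
have yZ : y - i n w \in cycles B n.
  by apply: bd_cycle; rewrite linearB /= -zE -cm_bdE wE subrr.
have -> : hclass C n (p n y) = Hmap p n (hclass B n (y - i n w)).
  by rewrite HmapE // [p n (_ - _)]linearB /= quotc_pi0E subr0.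
by rewrite memv_img ?memvf.
Qed.

Lemma exact_left n : (limg (connecting n) = lker (Hmap i (n - 1)))%VS.
Proof.
apply/vspaceP => a; rewrite memv_ker; apply/idP/idP.
  case/memv_imgP => b _ ->; have [y [z zE ->]] := connecting_surj b.
  rewrite (connectingE zE) HmapE ?(connecting_cycle zE) // zE.
  by rewrite hclass_bd.
have [z zZ ->] := hclass_surj a; rewrite HmapE // => /eqP iz0.
have [y yE] := hclass0P (esym (subrK 1 n)) (cm_cycle i zZ) iz0.
by rewrite -(connectingE (esym yE)) memv_img ?memvf.
Qed.

End QuotientComplex.

Section Convex.
Variables (disp : Order.disp_t) (P : finPOrderType disp).

Definition convex (I : {set P}) : bool :=
  [forall p in I, forall q in I, forall x, (p <= x <= q)%O ==> (x \in I)].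

Record convex_set := ConvexSet { cvx_set :> {set P}; _ : convex cvx_set }.

Definition adjacent (s : seq {set P}) : bool :=
  pairwise (fun I J : {set P} => [disjoint I & J] &&
     [forall p in I, forall q in J, ~~ (q < p)%O]) s
  && convex (\bigcup_(I <- s) I).

(* (I, J) is an adjacent pair and IJ is its union. Maps attached to an      *)
(* adjacent pair take a (boolean, hence unique) proof of this as argument.  *)
Definition adj_pair (I J IJ : convex_set) : bool :=
  adjacent [:: (I : {set P}); (J : {set P})] && ((IJ : {set P}) == I :|: J).

Definition adj_triple (I J K : convex_set) : bool :=
  adjacent [:: (I : {set P}); (J : {set P}); (K : {set P})].

Definition incomparable (I J : convex_set) : bool :=
  [forall p in I, forall q in J, (p >< q)%O].

Lemma convexP (I : convex_set) p q x :
  p \in I -> q \in I -> (p <= x)%O -> (x <= q)%O -> x \in I.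
Proof.
case: I => I /= /forall_inP cI pI qI px xq.
by move/forall_inP: (cI p pI) => /(_ q qI)/forallP/(_ x); rewrite px xq.
Qed.

Lemma adj_pairP I J IJ : adj_pair I J IJ ->
  [/\ (IJ : {set P}) = I :|: J, [disjoint I & J] &
      forall p q, p \in I -> q \in J -> ~~ (q < p)%O].
Proof.
case/andP => /andP[/= + _] /eqP->; rewrite !andbT => /andP[-> lt]; split=> //.
by move=> p q pI qJ; move/forall_inP: lt => /(_ p pI)/forall_inP/(_ q qJ).
Qed.

Lemma adjacent_triple_pairs (I J L : convex_set) : adj_triple I J L ->
  exists IJ JL IJL : convex_set,
    [/\ adj_pair I J IJ, adj_pair J L JL, adj_pair I JL IJL & adj_pair IJ L IJL].
Proof.
case/andP => /=; rewrite !andbT => /andP[/andP[]].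
move=> /andP[dIJ ltIJ] /andP[dIL ltIL] /andP[dJL ltJL].
have ltE (A B : {set P}) : [forall p in A, forall q in B, ~~ (q < p)%O] ->
    forall p q, p \in A -> q \in B -> ~~ (q < p)%O.
  by move=> h p q pA qB; move/forall_inP: h => /(_ p pA)/forall_inP/(_ q qB).
have Elt (A B : {set P}) : (forall p q, p \in A -> q \in B -> ~~ (q < p)%O) ->
    [forall p in A, forall q in B, ~~ (q < p)%O].
  by move=> h; apply/forall_inP => p pA; apply/forall_inP => q; exact: h.
rewrite !big_cons big_nil setU0 => cIJL.
have cU p q x : p \in I :|: (J :|: L) -> q \in I :|: (J :|: L) ->
    (p <= x)%O -> (x <= q)%O -> x \in I :|: (J :|: L).
  exact: (@convexP (ConvexSet cIJL)).
have cI (A : {set P}) : (forall p q x, p \in A -> q \in A ->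
    (p <= x)%O -> (x <= q)%O -> x \in A) -> convex A.
  move=> h; apply/forall_inP => p pA; apply/forall_inP => q qA.
  by apply/forallP => x; apply/implyP => /andP[]; exact: h.
have cIJ : convex (I :|: J).
  apply: (cI) => p q x pA qA px xq.
  have := cU p q x; rewrite setUA ![_ \in _ :|: L]inE pA qA.
  move=> /(_ isT isT px xq) /orP[//|xL].
  have xq' : (x < q)%O.
    rewrite lt_neqAle xq andbT; apply: contraTneq xL => ->.
    move: qA; rewrite inE => /orP[qI|qJ].
      by rewrite (disjointFr dIL qI).
    by rewrite (disjointFr dJL qJ).
  move: qA; rewrite inE => /orP[qI|qJ].
    by have := ltE _ _ ltIL q x qI xL; rewrite xq'.
  by have := ltE _ _ ltJL q x qJ xL; rewrite xq'.
have cJL : convex (J :|: L).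
  apply: (cI) => p q x pA qA px xq.
  have := cU p q x; rewrite ![_ \in I :|: _]inE pA qA !orbT.
  move=> /(_ isT isT px xq) /orP[xI|//].
  have px' : (p < x)%O.
    rewrite lt_neqAle px andbT; apply: contraTneq xI => <-.
    move: pA; rewrite inE => /orP[pJ|pL].
      by rewrite (disjointFl dIJ pJ).
    by rewrite (disjointFl dIL pL).
  move: pA; rewrite inE => /orP[pJ|pL].
    by have := ltE _ _ ltIJ x p xI pJ; rewrite px'.
  by have := ltE _ _ ltIL x p xI pL; rewrite px'.
exists (ConvexSet cIJ), (ConvexSet cJL), (ConvexSet cIJL).
rewrite /adj_pair /adjacent /= !big_cons !big_nil !setU0 !eqxx /= !andbT.
rewrite dIJ ltIJ dJL ltJL cIJ cJL -setUA eqxx cIJL !andbT /=.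
split=> //.
  rewrite -setI_eq0 setIUr setU_eq0 !setI_eq0 dIJ dIL; apply: Elt => p q pI.
  by rewrite inE => /orP[]; [apply: (ltE _ _ ltIJ)|apply: (ltE _ _ ltIL)].
rewrite -setI_eq0 setIUl setU_eq0 !setI_eq0 dIL dJL; apply: Elt => p q + qL.
rewrite inE => /orP[] h.
  exact: ltE ltIL _ _ h qL.
exact: ltE ltJL _ _ h qL.
Qed.

End Convex.

Section Braids.
Variables (disp : Order.disp_t) (P : finPOrderType disp) (K : fieldType).
Implicit Types I J L IJ JL IJL : convex_set P.

Record chain_complex_braid := ChainComplexBraid {
  cb_cc :> convex_set P -> chain_complex K;
  cb_i : forall I J IJ, adj_pair I J IJ -> chain_map (cb_cc I) (cb_cc IJ);
  cb_p : forall I J IJ, adj_pair I J IJ -> chain_map (cb_cc IJ) (cb_cc J);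
  cb_inj : forall I J IJ (a : adj_pair I J IJ) n, injective (cb_i a n);
  cb_pi0 : forall I J IJ (a : adj_pair I J IJ) n, cb_p a n \o cb_i a n = 0;
  cb_qis : forall I J IJ (a : adj_pair I J IJ),
    quasi_iso (quotc_lift (cb_pi0 a));
  cb_pi1 : forall I J IJ (a : adj_pair I J IJ) (b : adj_pair J I IJ),
    incomparable I J -> forall n, cb_p b n \o cb_i a n = \1;
  cb_triple : forall I J L IJ JL IJL
    (a12 : adj_pair I J IJ) (a23 : adj_pair J L JL)
    (a1 : adj_pair I JL IJL) (a3 : adj_pair IJ L IJL), adj_triple I J L ->
    forall n,
    [/\ cb_i a3 n \o cb_i a12 n = cb_i a1 n,
        cb_p a23 n \o cb_p a1 n = cb_p a3 n &
        cb_i a23 n \o cb_p a12 n = cb_p a1 n \o cb_i a3 n] }.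

Record graded_module_braid := GradedModuleBraid {
  mb_space :> convex_set P -> int -> vectType K;
  mb_i : forall I J IJ, adj_pair I J IJ ->
    forall n : int, 'Hom(mb_space I n, mb_space IJ n);
  mb_p : forall I J IJ, adj_pair I J IJ ->
    forall n : int, 'Hom(mb_space IJ n, mb_space J n);
  mb_d : forall I J IJ, adj_pair I J IJ ->
    forall n : int, 'Hom(mb_space J n, mb_space I (n - 1));
  mb_exact : forall I J IJ (a : adj_pair I J IJ) n,
    [/\ (limg (mb_i a n) = lker (mb_p a n))%VS,
        (limg (mb_p a n) = lker (mb_d a n))%VS &
        (limg (mb_d a n) = lker (mb_i a (n - 1)))%VS];
  mb_pi1 : forall I J IJ (a : adj_pair I J IJ) (b : adj_pair J I IJ),
    incomparable I J -> forall n, mb_p b n \o mb_i a n = \1;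
  mb_triple : forall I J L IJ JL IJL
    (a12 : adj_pair I J IJ) (a23 : adj_pair J L JL)
    (a1 : adj_pair I JL IJL) (a3 : adj_pair IJ L IJL), adj_triple I J L ->
    forall n,
    [/\ mb_i a3 n \o mb_i a12 n = mb_i a1 n,
        mb_p a23 n \o mb_p a1 n = mb_p a3 n &
        mb_i a23 n \o mb_p a12 n = mb_p a1 n \o mb_i a3 n] /\
    [/\ mb_p a12 (n - 1) \o mb_d a3 n = mb_d a23 n,
        mb_d a1 n \o mb_i a23 n = mb_d a12 n &
        mb_d a3 n \o mb_p a23 n = mb_i a12 (n - 1) \o mb_d a1 n] }.

Record braid_morphism (G G' : graded_module_braid) := BraidMorphism {
  bm_fun :> forall I (n : int), 'Hom(G I n, G' I n);
  bm_i : forall I J IJ (a : adj_pair I J IJ) n,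
    bm_fun IJ n \o mb_i G a n = mb_i G' a n \o bm_fun I n;
  bm_p : forall I J IJ (a : adj_pair I J IJ) n,
    bm_fun J n \o mb_p G a n = mb_p G' a n \o bm_fun IJ n;
  bm_d : forall I J IJ (a : adj_pair I J IJ) n,
    bm_fun I (n - 1) \o mb_d G a n = mb_d G' a n \o bm_fun J n }.

Definition braid_isomorphic (G G' : graded_module_braid) : Prop :=
  exists (f : braid_morphism G G') (g : braid_morphism G' G),
    forall I n, g I n \o f I n = \1 /\ f I n \o g I n = \1.

Section HomologyBraid.
Variable C : chain_complex_braid.

Definition hb_i I J IJ (a : adj_pair I J IJ) n := Hmap (cb_i C a) n.
Definition hb_p I J IJ (a : adj_pair I J IJ) n := Hmap (cb_p C a) n.
Definition hb_d I J IJ (a : adj_pair I J IJ) n := connecting (cb_pi0 C a) n.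

Lemma hb_exact I J IJ (a : adj_pair I J IJ) n :
  [/\ (limg (hb_i a n) = lker (hb_p a n))%VS,
      (limg (hb_p a n) = lker (hb_d a n))%VS &
      (limg (hb_d a n) = lker (hb_i a (n - 1)))%VS].
Proof.
have inj := @cb_inj C _ _ _ a; have qis := cb_qis C a.
by split; [exact: exact_mid inj qis n|exact: exact_right inj qis n|
  exact: exact_left inj qis n].
Qed.

Lemma hb_pi1 I J IJ (a : adj_pair I J IJ) (b : adj_pair J I IJ) :
  incomparable I J -> forall n, hb_p b n \o hb_i a n = \1.
Proof.
move=> inc n; apply/lfunP => c; have [x xZ ->] := hclass_surj c.
rewrite comp_lfunE !HmapE ?cm_cycle // id_lfunE.
by rewrite -[cb_p _ _ _ _]comp_lfunE cb_pi1 // id_lfunE.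
Qed.

Lemma hb_triple I J L IJ JL IJL
    (a12 : adj_pair I J IJ) (a23 : adj_pair J L JL)
    (a1 : adj_pair I JL IJL) (a3 : adj_pair IJ L IJL) :
    adj_triple I J L -> forall n,
  [/\ hb_i a3 n \o hb_i a12 n = hb_i a1 n,
      hb_p a23 n \o hb_p a1 n = hb_p a3 n &
      hb_i a23 n \o hb_p a12 n = hb_p a1 n \o hb_i a3 n] /\
  [/\ hb_p a12 (n - 1) \o hb_d a3 n = hb_d a23 n,
      hb_d a1 n \o hb_i a23 n = hb_d a12 n &
      hb_d a3 n \o hb_p a23 n = hb_i a12 (n - 1) \o hb_d a1 n].
Proof.
move=> t n.
have T m := cb_triple C a12 a23 a1 a3 t m.
have iiE m x : cb_i C a3 m (cb_i C a12 m x) = cb_i C a1 m x.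
  by have [<- _ _] := T m; rewrite comp_lfunE.
have ppE m x : cb_p C a23 m (cb_p C a1 m x) = cb_p C a3 m x.
  by have [_ <- _] := T m; rewrite comp_lfunE.
have ipE m x : cb_i C a23 m (cb_p C a12 m x) = cb_p C a1 m (cb_i C a3 m x).
  by have [_ _ E] := T m; rewrite -!comp_lfunE E.
have dE I' J' IJ' (a : adj_pair I' J' IJ') y z
    (zE : cb_i C a (n - 1) z = bd (C IJ') n (n - 1) y) :
    hb_d a n (hclass (C J') n (cb_p C a n y)) = hclass (C I') (n - 1) z.
  exact: (connectingE (@cb_inj C _ _ _ a) (cb_qis C a) zE).
have dS I' J' IJ' (a : adj_pair I' J' IJ') := connecting_surj (cb_qis C a) (n := n).
have dZ I' J' IJ' (a : adj_pair I' J' IJ') y z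
    (zE : cb_i C a (n - 1) z = bd (C IJ') n (n - 1) y) :=
  connecting_cycle (cb_pi0 C a) (@cb_inj C _ _ _ a) zE.
split; split; apply/lfunP => c.
- have [x xZ ->] := hclass_surj c.
  by rewrite comp_lfunE !HmapE ?cm_cycle // iiE.
- have [x xZ ->] := hclass_surj c.
  by rewrite comp_lfunE !HmapE ?cm_cycle // ppE.
- have [x xZ ->] := hclass_surj c.
  by rewrite 2!comp_lfunE !HmapE ?cm_cycle // ipE.
- have [y [z zE ->]] := dS _ _ _ a3 c.
  rewrite comp_lfunE (dE _ _ _ _ _ _ zE) HmapE ?(dZ _ _ _ _ _ _ zE) //.
  by rewrite -ppE (@dE _ _ _ a23 _ (cb_p C a12 (n - 1) z)) // ipE zE cm_bdE.
- have [y [z zE ->]] := dS _ _ _ a12 c.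
  rewrite comp_lfunE (dE _ _ _ _ _ _ zE) HmapE ?(dZ _ _ _ _ _ _ zE) //.
  by rewrite ipE (@dE _ _ _ a1 _ z) // -iiE zE cm_bdE.
have [y [z zE ->]] := dS _ _ _ a1 c.
rewrite 2!comp_lfunE (dE _ _ _ _ _ _ zE) !HmapE ?(dZ _ _ _ _ _ _ zE) //.
by rewrite ppE (@dE _ _ _ a3 _ (cb_i C a12 (n - 1) z)) // iiE zE.
Qed.

Definition homology_braid : graded_module_braid :=
  GradedModuleBraid hb_exact hb_pi1 hb_triple.

End HomologyBraid.

End Braids.

Section GradedComplexes.
Variables (disp : Order.disp_t) (P : finPOrderType disp) (K : fieldType).

Record grading (V : vectType K) := Grading {
  gproj :> P -> 'End(V);
  gproj_idem : forall p, gproj p \o gproj p = gproj p;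
  gproj_orth : forall p q, p != q -> gproj p \o gproj q = 0;
  gproj_sum : \sum_p gproj p = \1 }.

Definition filtered (V W : vectType K) (piV : grading V) (piW : grading W)
    (f : 'Hom(V, W)) : Prop :=
  forall p q, piW p \o f \o piV q != 0 -> (p <= q)%O.

Record graded_complex := GradedComplex {
  gc_cc :> chain_complex K;
  gc_pi : forall n : int, grading (gc_cc n);
  gc_filtered : forall i j, filtered (gc_pi i) (gc_pi j) (bd gc_cc i j) }.

Definition strict (C : graded_complex) : Prop :=
  forall p j, gc_pi C (j - 1) p \o bd C j (j - 1) \o gc_pi C j p = 0.

Definition filtered_map (C D : graded_complex) (f : chain_map C D) : Prop :=
  forall n, filtered (gc_pi C n) (gc_pi D n) (f n).

(* As for boundaries, a homotopy is a family h i j : C_i -> D_j that        *)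
(* vanishes unless j = i + 1.                                               *)
Definition filtered_homotopic (C D : graded_complex)
    (f g : forall n : int, 'Hom(C n, D n)) : Prop :=
  exists h : forall i j : int, 'Hom(C i, D j),
    [/\ forall i j, j != i + 1 -> h i j = 0,
        forall i j, filtered (gc_pi C i) (gc_pi D j) (h i j) &
        forall n, f n - g n =
          (bd D (n + 1) n \o h n (n + 1)) + (h (n - 1) n \o bd C n (n - 1))].

Definition filtered_chain_equivalent (C D : graded_complex) : Prop :=
  exists (f : chain_map C D) (g : chain_map D C),
    [/\ filtered_map f, filtered_map g,
        filtered_homotopic (fun n => g n \o f n) (fun n => \1) &
        filtered_homotopic (fun n => f n \o g n) (fun n => \1)].

(* C' is a Conley complex for C. *)
Definition conley_complex (C C' : graded_complex) : Prop :=
  strict C' /\ filtered_chain_equivalent C' C.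

End GradedComplexes.

Section BraidOfComplex.
Variables (disp : Order.disp_t) (P : finPOrderType disp) (K : fieldType).
Variable C : graded_complex P K.
Implicit Types I J L IJ JL IJL : convex_set P.

Local Notation pi := (gc_pi C).

(* C^I, the (internal) direct sum of the C^p = im pi^p for p in I. *)
Definition gsub (I : {set P}) (n : int) : {vspace C n} :=
  (\sum_(p in I) limg (pi n p))%VS.

Definition gsum (I : {set P}) (n : int) : 'End(C n) := \sum_(p in I) pi n p.

Definition gincl (I : {set P}) (n : int) : 'Hom(subvs_of (gsub I n), C n) :=
  subv_incl (gsub I n).
Definition gproject (I : {set P}) (n : int) : 'Hom(C n, subvs_of (gsub I n)) :=
  subv_proj (gsub I n) \o gsum I n.

Lemma gprojE n p q x : pi n p (pi n q x) = if p == q then pi n p x else 0.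
Proof.
rewrite -comp_lfunE; have [->|pq] := eqVneq p q; first by rewrite gproj_idem.
by rewrite gproj_orth ?zero_lfunE.
Qed.

Lemma gsumE (I : {set P}) n x : gsum I n x = \sum_(p in I) pi n p x.
Proof. by rewrite /gsum sum_lfunE. Qed.

Lemma gsum_gsub (I : {set P}) n x : gsum I n x \in gsub I n.
Proof.
rewrite gsumE; apply: rpred_sum => p pI.
by apply: (subvP (sumv_sup p pI (subvv _))); rewrite memv_img ?memvf.
Qed.

Lemma gproj_gsub (I : {set P}) n p x : x \in gsub I n ->
  pi n p x = if p \in I then pi n p x else 0.
Proof.
case: ifPn => // pI /memv_sumP[v vI ->]; rewrite linear_sum big1 // => q qI.
have /memv_imgP[y _ ->] := vI q qI; rewrite /= gprojE.
by case: eqVneq pI => // ->; rewrite qI.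
Qed.

Lemma gproj_total n x : \sum_p pi n p x = x.
Proof. by rewrite -[RHS]id_lfunE -(gproj_sum (pi n)) sum_lfunE. Qed.

Lemma gsum_id (I : {set P}) n x : x \in gsub I n -> gsum I n x = x.
Proof.
move=> xI; rewrite gsumE -[RHS]gproj_total big_mkcond; apply: eq_bigr => p _.
by rewrite -gproj_gsub.
Qed.

Lemma gsum_gsum (I J : {set P}) n x :
  gsum I n (gsum J n x) = gsum (I :&: J) n x.
Proof.
rewrite !gsumE.
rewrite (eq_bigr (fun p => \sum_(q in J) pi n p (pi n q x))); last first.
  by move=> p _; rewrite linear_sum.
rewrite [RHS](eq_bigl (fun p => (p \in I) && (p \in J))); last first.
  by move=> p; rewrite inE.
rewrite [RHS]big_mkcondr; apply: eq_bigr => p _.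
under eq_bigr do rewrite gprojE.
rewrite -big_mkcondr big_mkcond /=.
have [pJ|pJ] := boolP (p \in J).
  rewrite (bigD1 p) //= pJ eqxx /= big1 ?addr0 // => q qp.
  by rewrite eq_sym (negPf qp) andbF.
by rewrite big1 // => q _; case: eqP => [<-|]; rewrite ?andbF // (negPf pJ).
Qed.

Lemma gproj_bd0 i j p q x : ~~ (p <= q)%O -> pi j p (bd C i j (pi i q x)) = 0.
Proof.
move=> pq; rewrite -!comp_lfunE.
have [->|/(gc_filtered (g := C)) pq'] :=
  eqVneq (pi j p \o bd C i j \o pi i q) 0; first by rewrite zero_lfunE.
by rewrite pq' in pq.
Qed.

Lemma gsum_bd0 (I J : {set P}) i j x :
    (forall p q, p \in I -> q \in J -> ~~ (p <= q)%O) ->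
  gsum I j (bd C i j (gsum J i x)) = 0.
Proof.
move=> IJ; rewrite gsumE big1 // => p pI; rewrite gsumE !linear_sum big1 //.
by move=> q qJ; rewrite /= gproj_bd0 ?IJ.
Qed.

Lemma gsumC (I : {set P}) n x : gsum I n x + gsum (~: I) n x = x.
Proof.
rewrite -[RHS]gproj_total !gsumE [RHS](bigID (mem I)) /=; congr (_ + _).
by apply: eq_bigl => p; rewrite inE.
Qed.

Lemma gproject_incl (I : {set P}) n x : gincl I n (gproject I n x) = gsum I n x.
Proof. by rewrite /gproject comp_lfunE subv_projK ?gsum_gsub. Qed.

Lemma gsum_incl (I : {set P}) n x : gsum I n (gincl I n x) = gincl I n x.
Proof. by rewrite gsum_id ?subv_inclP. Qed.

Lemma gincl_inj (I : {set P}) n : injective (gincl I n).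
Proof. exact: subv_incl_inj. Qed.

Lemma gprojectK (I : {set P}) n x : gproject I n (gincl I n x) = x.
Proof. by rewrite /gproject comp_lfunE gsum_incl subv_inclK. Qed.

Definition gb_bd (I : {set P}) (i j : int) :
    'Hom(subvs_of (gsub I i), subvs_of (gsub I j)) :=
  gproject I j \o bd C i j \o gincl I i.

Lemma gb_bdE (I : {set P}) i j x :
  gincl I j (gb_bd I i j x) = gsum I j (bd C i j (gincl I i x)).
Proof. by rewrite /gb_bd 2!comp_lfunE gproject_incl. Qed.

Lemma gb_bd_shape (I : {set P}) i j : i != j + 1 -> gb_bd I i j = 0.
Proof. by move=> ij; rewrite /gb_bd bd_shape // comp_lfun0r comp_lfun0l. Qed.

Lemma gsum_bdC I i j k x : x \in gsub I i ->
  gsum I k (bd C j k (gsum (~: I) j (bd C i j x))) = 0.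
Proof.
move=> /gsum_id <-; rewrite !gsumE big1 // => p pI.
rewrite !linear_sum big1 //= => q qI; rewrite !linear_sum big1 //= => r rI.
have [pq|pq] := boolP (p <= q)%O; last by rewrite gproj_bd0.
have [qr|qr] := boolP (q <= r)%O; last by rewrite [pi j q _]gproj_bd0 // !linear0.
by move: qI; rewrite inE (convexP pI rI pq qr).
Qed.

Lemma gb_bd_bd I i j k : gb_bd I j k \o gb_bd I i j = 0.
Proof.
apply/lfunP => x; apply: (@gincl_inj I k).
rewrite comp_lfunE !gb_bdE zero_lfunE linear0.
have := gsumC I (bd C i j (gincl I i x)).
move/(canRL (addrK _)) ->; rewrite !linearB /= bd_bdE linear0 sub0r.
by rewrite gsum_bdC ?oppr0 ?subv_inclP.
Qed.

Definition gb_cc I : chain_complex K :=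
  ChainComplex (@gb_bd_shape I) (@gb_bd_bd I).

(* The natural map C^I -> C^L: the inclusion if I is a subset of L, the     *)
(* projection if L is a subset of I.                                        *)
Definition gnat (I L : {set P}) (n : int) :
    'Hom(subvs_of (gsub I n), subvs_of (gsub L n)) :=
  gproject L n \o gincl I n.

Lemma gnatE (I L : {set P}) n x :
  gincl L n (gnat I L n x) = gsum L n (gincl I n x).
Proof. by rewrite /gnat comp_lfunE gproject_incl. Qed.

Lemma gnat_comp (I J L : {set P}) n : I :&: L \subset J ->
  gnat J L n \o gnat I J n = gnat I L n.
Proof.
move=> /setIidPl sJ; apply/lfunP => x; apply: (@gincl_inj L n).
rewrite comp_lfunE !gnatE -(gsum_incl x) !gsum_gsum.
by rewrite -setIA -[J :&: I]setIC setIA [L :&: I]setIC sJ.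
Qed.

Lemma gnat_id (I : {set P}) n : gnat I I n = \1.
Proof. by apply/lfunP => x; rewrite /gnat comp_lfunE gprojectK id_lfunE. Qed.

Lemma gnat0 (I L : {set P}) n : [disjoint I & L] -> gnat I L n = 0.
Proof.
rewrite -setI_eq0 => /eqP IL; apply/lfunP => x; apply: (@gincl_inj L n).
rewrite gnatE -(gsum_incl x) gsum_gsum setIC IL gsumE big_set0.
by rewrite zero_lfunE linear0.
Qed.

Section Pair.
Variables (I J IJ : convex_set P) (a : adj_pair I J IJ).

Let IJE : (IJ : {set P}) = I :|: J. Proof. by case: (adj_pairP a). Qed.
Let disj : [disjoint I & J]. Proof. by case: (adj_pairP a). Qed.
Let ltF p q : p \in I -> q \in J -> ~~ (q <= p)%O.
Proof.
case: (adj_pairP a) => _ _ lt pI qJ; rewrite le_eqVlt negb_or lt // andbT.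
apply: contraTneq pI => <-; by rewrite (disjointFl disj qJ).
Qed.

Let sI : (I : {set P}) \subset IJ. Proof. by rewrite IJE subsetUl. Qed.
Let sJ : (J : {set P}) \subset IJ. Proof. by rewrite IJE subsetUr. Qed.

Let gsumU n x : gsum IJ n x = gsum I n x + gsum J n x.
Proof.
rewrite IJE !gsumE -bigU //=; apply: eq_bigl => p.
by rewrite !inE.
Qed.

Lemma gb_i_bd i j : gnat I IJ j \o bd (gb_cc I) i j =
  bd (gb_cc IJ) i j \o gnat I IJ i.
Proof.
apply/lfunP => x; apply: (@gincl_inj IJ j).
rewrite [in LHS]comp_lfunE [in RHS]comp_lfunE gnatE /= !gb_bdE gnatE gsum_gsum (setIidPr sI).
rewrite -(gsum_incl x) gsum_gsum (setIidPr sI) gsumU.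
by rewrite [gsum J _ _]gsum_bd0 ?addr0 // => p q pJ qI; rewrite ltF.
Qed.

Lemma gb_p_bd i j : gnat IJ J j \o bd (gb_cc IJ) i j =
  bd (gb_cc J) i j \o gnat IJ J i.
Proof.
apply/lfunP => x; apply: (@gincl_inj J j).
rewrite [in LHS]comp_lfunE [in RHS]comp_lfunE gnatE /= !gb_bdE gnatE gsum_gsum (setIidPl sJ).
rewrite -{1}(gsum_incl x) gsumU !linearD /= gsum_bd0 ?add0r // => p q pJ qI.
by rewrite ltF.
Qed.

Definition gb_i : chain_map (gb_cc I) (gb_cc IJ) :=
  @ChainMap _ (gb_cc I) (gb_cc IJ) (gnat I IJ) gb_i_bd.
Definition gb_p : chain_map (gb_cc IJ) (gb_cc J) :=
  @ChainMap _ (gb_cc IJ) (gb_cc J) (gnat IJ J) gb_p_bd.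

Lemma gb_inj n : injective (gb_i n).
Proof.
apply: (can_inj (g := gnat IJ I n)) => x.
by rewrite -comp_lfunE gnat_comp ?setIid // gnat_id id_lfunE.
Qed.

Lemma gb_pi0 n : gb_p n \o gb_i n = 0.
Proof. by rewrite /= gnat_comp ?gnat0 // (subset_trans _ sI) ?subsetIl. Qed.

Lemma gb_qis : quasi_iso (quotc_lift gb_pi0).
Proof.
apply: bij_quasi_iso => n.
have split_x x : gnat J IJ n (gnat IJ J n x) + gnat I IJ n (gnat IJ I n x) = x.
  apply: (@gincl_inj IJ n); rewrite linearD /= !gnatE !gsum_gsum.
  by rewrite (setIidPr sJ) (setIidPr sI) addrC -gsumU gsum_incl.
exists (fun y => quotmap (limg (gb_i n)) (gnat J IJ n y)).
  move=> b; have [x <-] := quotmap_surj b; rewrite (quotc_lift_funE gb_pi0).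
  apply/eqP; rewrite -subr_eq0 -linearB quotmap_eq0.
  apply/memv_imgP; exists (- gnat IJ I n x); rewrite ?memvf //=.
  by rewrite -{2}(split_x x) opprD addrA subrr sub0r linearN.
move=> y; rewrite (quotc_lift_funE gb_pi0) /= -comp_lfunE.
by rewrite gnat_comp ?setIid // gnat_id id_lfunE.
Qed.

End Pair.

Lemma gb_pi1 I J IJ (a : adj_pair I J IJ) (b : adj_pair J I IJ) :
  incomparable I J -> forall n, gb_p b n \o gb_i a n = \1.
Proof.
move=> _ n; have [IJE _ _] := adj_pairP a.
by rewrite /= gnat_comp ?gnat_id // setIid IJE subsetUl.
Qed.

Lemma gb_triple I J L IJ JL IJL
    (a12 : adj_pair I J IJ) (a23 : adj_pair J L JL)
    (a1 : adj_pair I JL IJL) (a3 : adj_pair IJ L IJL) :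
    adj_triple I J L -> forall n,
  [/\ gb_i a3 n \o gb_i a12 n = gb_i a1 n,
      gb_p a23 n \o gb_p a1 n = gb_p a3 n &
      gb_i a23 n \o gb_p a12 n = gb_p a1 n \o gb_i a3 n].
Proof.
move=> _ n; have [E12 _ _] := adj_pairP a12; have [E23 _ _] := adj_pairP a23.
have [E1 d1 _] := adj_pairP a1; have [_ d3 _] := adj_pairP a3.
have d : IJ :&: JL \subset J.
  apply/subsetP => p; rewrite E12 !inE E23 inE => /andP[/orP[pI|//] pJL].
  by have := disjointFr d1 pI; rewrite E23 inE pJL.
split; rewrite /= ?gnat_comp //.
- by rewrite E12 (subset_trans (subsetIl _ _)) ?subsetUl.
- by rewrite E23 (subset_trans (subsetIr _ _)) ?subsetUr.
- by rewrite E1 E12 E23 setUA (subset_trans (subsetIl _ _)) ?subsetUl.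
Qed.

Definition complex_braid : chain_complex_braid P K :=
  ChainComplexBraid gb_inj gb_qis gb_pi1 gb_triple.

End BraidOfComplex.

Record cell_complex (K : fieldType) (dX : Order.disp_t) (X : finPOrderType dX)
    := CellComplex {
  cell_dim : X -> nat;
  kappa : X -> X -> K;
  cell_dim_mono : forall x y : X, (x <= y)%O -> (cell_dim x <= cell_dim y)%N;
  kappa_neq0 : forall x y : X, kappa x y != 0 ->
    (y <= x)%O /\ cell_dim x = (cell_dim y + 1)%N;
  kappa_kappa : forall x z : X, \sum_y kappa x y * kappa y z = 0 }.

Record graded_cell_complex (K : fieldType)
    (dP : Order.disp_t) (P : finPOrderType dP)
    (dX : Order.disp_t) (X : finPOrderType dX) := GradedCellComplex {
  gcell :> cell_complex K X;
  nu : X -> P;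
  nu_mono : forall x y : X, (x <= y)%O -> (nu x <= nu y)%O }.

Section CellChains.
Variables (K : fieldType) (dX : Order.disp_t) (X : finPOrderType dX).
Variable XX : cell_complex K X.

(* The cells of dimension n; there are none for n < 0. *)
Definition cells (n : int) : finType :=
  {x : X | (cell_dim XX x)%:Z == n}.

(* The chain c stands for the sum of the c x *: x; the cell x is the        *)
(* indicator function of x.                                                 *)
Definition cell_chains (n : int) : vectType K := {ffun cells n -> K^o}.

Definition cell_bd_fun (i j : int) (c : cell_chains i) : cell_chains j :=
  [ffun y : cells j => \sum_(x : cells i) c x * kappa XX (val x) (val y)].

Lemma cell_bd_fun_linear i j : linear (@cell_bd_fun i j).
Proof.
move=> k c c'; apply/ffunP => y; rewrite !ffunE scaler_sumr -big_split /=.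
by apply: eq_bigr => x _; rewrite !ffunE mulrDl scalerAl.
Qed.

HB.instance Definition _ i j := GRing.isLinear.Build K
  (cell_chains i) (cell_chains j) _ (@cell_bd_fun i j) (@cell_bd_fun_linear i j).

(* Only j = i - 1 contributes, as kappa x y = 0 unless dim x = dim y + 1.   *)
Definition cell_bd (i j : int) : 'Hom(cell_chains i, cell_chains j) :=
  linfun (@cell_bd_fun i j).

Lemma cell_bdE i j c y :
  cell_bd i j c y = \sum_x c x * kappa XX (val x) (val y).
Proof. by rewrite lfunE ffunE. Qed.

Lemma kappa_dim i j (x : cells i) (y : cells j) :
  i != j + 1 -> kappa XX (val x) (val y) = 0.
Proof.
case: x y => x /= /eqP<- [y /= /eqP<-]; apply: contraNeq.
by move=> /kappa_neq0[_ ->]; rewrite PoszD.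
Qed.

Lemma cell_bd_shape i j : i != j + 1 -> cell_bd i j = 0.
Proof.
move=> ij; apply/lfunP => c; apply/ffunP => y; rewrite cell_bdE.
by rewrite zero_lfunE ffunE big1 // => x _; rewrite kappa_dim ?mulr0.
Qed.

Lemma cell_bd_bd i j k : cell_bd j k \o cell_bd i j = 0.
Proof.
have [ij|/cell_bd_shape->] := eqVneq i (j + 1); last by rewrite comp_lfun0r.
apply/lfunP => c; apply/ffunP => z; rewrite zero_lfunE ffunE.
rewrite comp_lfunE cell_bdE.
under eq_bigr do rewrite cell_bdE mulr_suml.
rewrite exchange_big big1 //= => x _.
under eq_bigr do rewrite -mulrA.
rewrite -mulr_sumr.
have := kappa_kappa XX (val x) (val z).
rewrite (bigID (fun y => (cell_dim XX y)%:Z == j)) /= [X in _ + X]big1 ?addr0.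
  rewrite (reindex_omap (val : cells j -> X) insub) => [|y yj]; last first.
    by rewrite insubT.
  move=> k0; rewrite [X in _ * X](_ : _ = 0) ?mulr0 // -[RHS]k0.
  by apply: eq_bigl => y; rewrite valK eqxx andbT; case: y => y /= ->.
move=> y yj; have [-> //|k0] := eqVneq (kappa XX (val x) y) 0.
  by rewrite mul0r.
have [_ dxE] := kappa_neq0 k0; case/negP: yj.
have := valP x; rewrite dxE ij PoszD => /eqP/addIr->; exact: eqxx.
Qed.

Definition cell_complex_chains : chain_complex K :=
  ChainComplex cell_bd_shape cell_bd_bd.

End CellChains.

Section GradedCellChains.
Variables (K : fieldType) (dP : Order.disp_t) (P : finPOrderType dP).
Variables (dX : Order.disp_t) (X : finPOrderType dX).
Variable XX : graded_cell_complex K P X.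

(* pi^nu: the projections onto the span of the cells of nu^-1(p). *)
Definition cell_proj_fun (n : int) (p : P) (c : cell_chains XX n) :
    cell_chains XX n :=
  [ffun x : cells XX n => if nu XX (val x) == p then c x else 0].

Lemma cell_proj_fun_linear n p : linear (@cell_proj_fun n p).
Proof.
move=> k c c'; apply/ffunP => x; rewrite !ffunE.
by case: eqP => // _; rewrite scaler0 addr0.
Qed.

HB.instance Definition _ n p := GRing.isLinear.Build K
  (cell_chains XX n) (cell_chains XX n) _ (@cell_proj_fun n p)
  (@cell_proj_fun_linear n p).

Definition cell_proj (n : int) (p : P) : 'End(cell_chains XX n) :=
  linfun (@cell_proj_fun n p).

Lemma cell_projE n p c x :
  cell_proj n p c x = if nu XX (val x) == p then c x else 0.
Proof. by rewrite lfunE ffunE. Qed.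

Lemma cell_proj_idem n p : cell_proj n p \o cell_proj n p = cell_proj n p.
Proof.
apply/lfunP => c; apply/ffunP => x; rewrite comp_lfunE !cell_projE.
by case: eqP.
Qed.

Lemma cell_proj_orth n p q : p != q -> cell_proj n p \o cell_proj n q = 0.
Proof.
move=> pq; apply/lfunP => c; apply/ffunP => x; rewrite comp_lfunE !cell_projE.
by rewrite zero_lfunE ffunE; case: eqP => // ->; rewrite (negPf pq).
Qed.

Lemma cell_proj_sum n : \sum_p cell_proj n p = \1.
Proof.
apply/lfunP => c; apply/ffunP => x; rewrite sum_lfunE sum_ffunE id_lfunE.
rewrite (bigD1 (nu XX (val x))) //= cell_projE eqxx big1 ?addr0 // => p pn.
by rewrite cell_projE eq_sym (negPf pn).
Qed.

Definition cell_grading (n : int) : grading P (cell_chains XX n) :=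
  Grading (@cell_proj_idem n) (@cell_proj_orth n) (cell_proj_sum n).

Lemma cell_filtered i j :
  filtered (cell_grading i) (cell_grading j) (cell_bd XX i j).
Proof.
move=> p q; apply: contraNT => pq; apply/eqP/lfunP => c; apply/ffunP => y.
rewrite 2!comp_lfunE [LHS]cell_projE zero_lfunE ffunE; case: eqP => // yp.
rewrite cell_bdE big1 // => x _; rewrite [X in X * _]cell_projE.
case: eqP => [xq|_]; last by rewrite mul0r.
apply/eqP; rewrite mulf_eq0; apply/orP; right.
by apply: contraNT pq => /kappa_neq0[/(nu_mono XX) + _]; rewrite yp xq.
Qed.

Definition cell_graded_complex : graded_complex P K :=
  @GradedComplex _ P K (cell_complex_chains XX) cell_grading cell_filtered.

Definition cell_braid : chain_complex_braid P K :=
  complex_braid cell_graded_complex.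

End GradedCellChains.

Definition connection_matrix (K : fieldType)
    (dP : Order.disp_t) (P : finPOrderType dP)
    (C : graded_complex P K) (G : graded_module_braid P K) : Prop :=
  braid_isomorphic (homology_braid (complex_braid C)) G /\ strict C.

(* Main.v *)
Require Import Defs.
From mathcomp Require Import all_boot order ssralg ssrint zmodp matrix vector.

(** Filtered maps are upper triangular: their components from [C^q] to [D^p]
    vanish unless [p <= q].  For a convex set [I], a composite passing from
    [C^I] through the complement of [I] and back to [D^I] would need
    [p <= r <= q] with [p] and [q] in [I] and [r] outside of [I]; so cutting
    filtered maps down to their diagonal block over [I] commutes with
    composition ([gres_comp]).  Being also additive and unital, the cut carries
    every equation between filtered maps to the blocks: chain maps remain chain
    maps, chain homotopies remain chain homotopies, and a filtered chain
    equivalence becomes, for every convex [I] at once, a chain equivalence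
    between the complexes of the two braids.

    On homology this gives isomorphisms [H(C^I) -> H(D^I)].  They respect the
    braid structure: for an adjacent pair [(I, J)] a filtered map has no
    component from [C^I] to [D^J], so the blocks commute with the inclusion of
    [C^I] into [C^IJ] and with the projection of [C^IJ] onto [C^J]
    ([gres_incl], [gres_proj]), and the connecting homomorphism is natural with
    respect to maps of short exact sequences ([connecting_natural]).  Hence the
    homology braid is an invariant of filtered chain equivalence
    ([filtered_equiv_homology_braid]).  A Conley complex is by definition
    strict and filtered chain equivalent to the given complex, and so its
    boundary is a connection matrix. *)

Set Implicit Arguments.
Unset Strict Implicit.
Unset Printing Implicit Defensive.

Import Order.TTheory GRing.Theory.
Local Open Scope ring_scope.
Local Open Scope lfun_scope.

(** * Maps induced on homology *)

(** Both classes are computed on one representative: if [z] lifts the boundary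
    of [y], then the image of [z] lifts the boundary of the image of [y]. *)
Lemma connecting_natural (K : fieldType) (A B C A' B' C' : chain_complex K)
    (i : chain_map A B) (p : chain_map B C) (pi0 : forall n, p n \o i n = 0)
    (i' : chain_map A' B') (p' : chain_map B' C')
    (pi0' : forall n, p' n \o i' n = 0)
    (alpha : chain_map A A') (beta : chain_map B B') (gamma : chain_map C C') :
    (forall n, injective (i n)) -> quasi_iso (quotc_lift pi0) ->
    (forall n, injective (i' n)) -> quasi_iso (quotc_lift pi0') ->
    (forall n, beta n \o i n = i' n \o alpha n) ->
    (forall n, gamma n \o p n = p' n \o beta n) ->
  forall n, Hmap alpha (n - 1) \o connecting pi0 n =
            connecting pi0' n \o Hmap gamma n.
Proof.
move=> injI qisP injI' qisP' natI natP n; apply/lfunP => c.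
have [y [z zE ->]] := connecting_surj qisP c.
have [zZ yZ] := connecting_cycle pi0 injI zE.
have zE' : i' (n - 1) (alpha (n - 1) z) = bd B' n (n - 1) (beta n y).
  by rewrite -cm_bdE -zE -!comp_lfunE natI.
rewrite [LHS]comp_lfunE [RHS]comp_lfunE (connectingE injI qisP zE) !HmapE //.
have -> : gamma n (p n y) = p' n (beta n y) by rewrite -!comp_lfunE natP.
by rewrite (connectingE injI' qisP' zE').
Qed.

Lemma Hmap_square (K : fieldType) (A B A' B' : chain_complex K)
    (u : chain_map A B) (v : chain_map A' B')
    (f : chain_map A A') (g : chain_map B B') (n : int) :
  g n \o u n = v n \o f n -> Hmap g n \o Hmap u n = Hmap v n \o Hmap f n.
Proof.
move=> E; apply/lfunP => c; have [x xZ ->] := hclass_surj c.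
rewrite 2!comp_lfunE !HmapE ?cm_cycle //.
by rewrite -[g n _]comp_lfunE -[v n _]comp_lfunE E.
Qed.

(** On a cycle the term that factors through the boundary vanishes, and the
    other one is a boundary. *)
Lemma Hmap_homotopic_id (K : fieldType) (A B : chain_complex K)
    (f : chain_map A B) (g : chain_map B A) (n : int)
    (s : 'Hom(A n, A (n + 1))) (t : 'Hom(A (n - 1), A n)) :
    g n \o f n - \1 = (bd A (n + 1) n \o s) + (t \o bd A n (n - 1)) ->
  Hmap g n \o Hmap f n = \1.
Proof.
move=> E; apply/lfunP => c; have [x xZ ->] := hclass_surj c.
rewrite comp_lfunE !HmapE ?cm_cycle // id_lfunE.
have gfE : g n (f n x) = x + bd A (n + 1) n (s x).
  have : (g n \o f n - \1) x = (bd A (n + 1) n \o s + (t \o bd A n (n - 1))) x.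
    by rewrite E.
  rewrite !add_lfunE opp_lfunE id_lfunE 3!comp_lfunE (cycle_bd _ xZ) linear0.
  by rewrite addr0 addrC => /(canRL (addNKr _)) ->.
by rewrite gfE -[RHS]addr0 -(@hclass_bd K A n (n + 1) (s x)); exact: linearD.
Qed.

(** * Diagonal blocks of filtered maps *)

Section DiagonalBlocks.
Variables (disp : Order.disp_t) (P : finPOrderType disp) (K : fieldType).
Implicit Types (C D E : graded_complex P K) (I J IJ : convex_set P).

(** The diagonal block [f^I = e^I f iota^I]; the boundary of the complex
    [C^I] is by definition the block of the boundary of [C]. *)
Definition gres C D (I : {set P}) (i j : int) (f : 'Hom(C i, D j)) :
    'Hom(subvs_of (gsub C I i), subvs_of (gsub D I j)) :=
  gproject D I j \o f \o gincl C I i.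

Lemma gresE C D (I : {set P}) i j (f : 'Hom(C i, D j)) x :
  gincl D I j (gres I f x) = gsum D I j (f (gincl C I i x)).
Proof. by rewrite /gres 2!comp_lfunE gproject_incl. Qed.

Lemma gresD C D (I : {set P}) i j (f g : 'Hom(C i, D j)) :
  gres I (f + g) = gres I f + gres I g.
Proof. by rewrite /gres comp_lfunDr comp_lfunDl. Qed.

Lemma gresB C D (I : {set P}) i j (f g : 'Hom(C i, D j)) :
  gres I (f - g) = gres I f - gres I g.
Proof. by rewrite /gres comp_lfunDr comp_lfunNr comp_lfunDl comp_lfunNl. Qed.

Lemma gres_id C (I : {set P}) n : gres I (\1 : 'End(C n)) = \1.
Proof.
by apply/lfunP => x; rewrite /gres 2!comp_lfunE !id_lfunE gprojectK.
Qed.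

Lemma filtered_proj0 C D i j (f : 'Hom(C i, D j)) p q x :
    filtered (gc_pi C i) (gc_pi D j) f -> ~~ (p <= q)%O ->
  gc_pi D j p (f (gc_pi C i q x)) = 0.
Proof.
move=> filf pq; rewrite -!comp_lfunE.
have [->|/filf pq'] := eqVneq (gc_pi D j p \o f \o gc_pi C i q) 0.
  by rewrite zero_lfunE.
by rewrite pq' in pq.
Qed.

Lemma filtered_gsum0 C D i j (f : 'Hom(C i, D j)) (I J : {set P}) x :
    filtered (gc_pi C i) (gc_pi D j) f ->
    (forall p q, p \in I -> q \in J -> ~~ (p <= q)%O) ->
  gsum D I j (f (gsum C J i x)) = 0.
Proof.
move=> filf IJ; rewrite gsumE big1 // => p pI; rewrite gsumE !linear_sum big1 //.
by move=> q qJ; rewrite /= filtered_proj0 ?IJ.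
Qed.

(** Each term of the expansion runs along a chain [p <= r <= q] with [p] and
    [q] in [I] and [r] outside, which convexity forbids. *)
Lemma filtered_gsum_detour C D E I i j k
    (f : 'Hom(C i, D j)) (g : 'Hom(D j, E k)) x :
    filtered (gc_pi C i) (gc_pi D j) f -> filtered (gc_pi D j) (gc_pi E k) g ->
  gsum E I k (g (gsum D (~: I) j (f (gsum C I i x)))) = 0.
Proof.
move=> filf filg; rewrite !gsumE big1 // => p pI.
rewrite linear_sum linear_sum big1 //= => r rI.
rewrite linear_sum [gc_pi D j r _]linear_sum !linear_sum big1 //= => q qI.
have [pr|pr] := boolP (p <= r)%O; last by rewrite (filtered_proj0 _ filg).
have [rq|rq] := boolP (r <= q)%O; last first.
  by rewrite (filtered_proj0 _ filf rq) !linear0.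
by move: rI; rewrite inE (convexP pI qI pr rq).
Qed.

(** Only the part of [f x] over [I] contributes to the block of the composite:
    the rest is a detour. *)
Lemma gres_comp C D E I i j k (f : 'Hom(C i, D j)) (g : 'Hom(D j, E k)) :
    filtered (gc_pi C i) (gc_pi D j) f -> filtered (gc_pi D j) (gc_pi E k) g ->
  gres I (g \o f) = gres I g \o gres I f.
Proof.
move=> filf filg; apply/lfunP => x; apply: (@gincl_inj _ _ _ E I k).
rewrite [in RHS]comp_lfunE !gresE comp_lfunE.
rewrite -{1}(gsumC I (f _)) !linearD /= -(gsum_incl x).
by rewrite filtered_gsum_detour // addr0.
Qed.

Section Pair.
Variables (C D : graded_complex P K) (n : int) (f : 'Hom(C n, D n)).
Hypothesis filf : filtered (gc_pi C n) (gc_pi D n) f.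
Variables (I J IJ : convex_set P) (a : adj_pair I J IJ).

Lemma adj_pair_not_le p q : p \in J -> q \in I -> ~~ (p <= q)%O.
Proof.
have [_ dIJ lt] := adj_pairP a => pJ qI.
rewrite le_eqVlt negb_or lt // andbT.
by apply: contraTneq qI => <-; rewrite (disjointFl dIJ pJ).
Qed.

Lemma gsum_adj_pair E m x : gsum E IJ m x = gsum E I m x + gsum E J m x.
Proof.
have [-> dIJ _] := adj_pairP a; rewrite !gsumE -bigU //=.
by apply: eq_bigl => p; rewrite !inE.
Qed.

(** The discrepancy between the two sides is the component of [f] from [C^I]
    to [D^J], which is zero because no element of [J] lies below one of [I]. *)
Lemma gres_incl :
  gres IJ f \o gnat C I IJ n = gnat D I IJ n \o gres I f.
Proof.
have [IJE _ _] := adj_pairP a.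
have sI : (I : {set P}) \subset IJ by rewrite IJE subsetUl.
apply/lfunP => x; apply: (@gincl_inj _ _ _ D IJ n).
rewrite 2!comp_lfunE gresE !gnatE gresE gsum_gsum (setIidPr sI).
rewrite -(gsum_incl x) gsum_gsum (setIidPr sI) gsum_adj_pair.
rewrite [gsum D J _ _](filtered_gsum0 _ filf) ?addr0 //.
exact: adj_pair_not_le.
Qed.

(** The same component of [f] is the discrepancy here. *)
Lemma gres_proj :
  gres J f \o gnat C IJ J n = gnat D IJ J n \o gres IJ f.
Proof.
have [IJE _ _] := adj_pairP a.
have sJ : (J : {set P}) \subset IJ by rewrite IJE subsetUr.
apply/lfunP => x; apply: (@gincl_inj _ _ _ D J n).
rewrite 2!comp_lfunE gresE !gnatE gresE gsum_gsum (setIidPl sJ).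
rewrite -[in RHS](gsum_incl x) gsum_adj_pair !linearD /=.
rewrite [gsum D J n (f (gsum C I n _))](filtered_gsum0 _ filf) ?add0r //.
exact: adj_pair_not_le.
Qed.

End Pair.

End DiagonalBlocks.

(** * Morphisms and isomorphisms of homology braids *)

Section InducedBraidMap.
Variables (disp : Order.disp_t) (P : finPOrderType disp) (K : fieldType).
Variables (C D : graded_complex P K) (f : chain_map C D).
Hypothesis filf : filtered_map f.

Lemma gres_bd (I : convex_set P) i j :
  gres I (f j) \o bd (gb_cc C I) i j = bd (gb_cc D I) i j \o gres I (f i).
Proof.
transitivity (gres I (f j \o bd C i j)).
  by rewrite (gres_comp I (@gc_filtered _ _ _ C i j) (@filf j)).
by rewrite cm_bd (gres_comp I (@filf i) (@gc_filtered _ _ _ D i j)).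
Qed.

Definition gres_map (I : convex_set P) : chain_map (gb_cc C I) (gb_cc D I) :=
  @ChainMap K (gb_cc C I) (gb_cc D I) (fun n => gres I (f n)) (gres_bd I).

Definition homology_braid_fun (I : convex_set P) (n : int) :=
  Hmap (gres_map I) n.

Lemma homology_braid_fun_i I J IJ (a : adj_pair I J IJ) n :
  homology_braid_fun IJ n \o hb_i (complex_braid C) a n =
  hb_i (complex_braid D) a n \o homology_braid_fun I n.
Proof. by apply: Hmap_square; apply: (gres_incl (@filf n) a). Qed.

Lemma homology_braid_fun_p I J IJ (a : adj_pair I J IJ) n :
  homology_braid_fun J n \o hb_p (complex_braid C) a n =
  hb_p (complex_braid D) a n \o homology_braid_fun IJ n.
Proof. by apply: Hmap_square; apply: (gres_proj (@filf n) a). Qed.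

Lemma homology_braid_fun_d I J IJ (a : adj_pair I J IJ) n :
  homology_braid_fun I (n - 1) \o hb_d (complex_braid C) a n =
  hb_d (complex_braid D) a n \o homology_braid_fun J n.
Proof.
apply: (connecting_natural (beta := gres_map IJ)).
- exact: gb_inj.
- exact: gb_qis.
- exact: gb_inj.
- exact: gb_qis.
- by move=> m; apply: (gres_incl (@filf m) a).
- by move=> m; apply: (gres_proj (@filf m) a).
Qed.

Definition homology_braid_map :
    braid_morphism (homology_braid (complex_braid C))
                   (homology_braid (complex_braid D)) :=
  @BraidMorphism _ P K (homology_braid (complex_braid C))
    (homology_braid (complex_braid D)) homology_braid_fun
    homology_braid_fun_i homology_braid_fun_p homology_braid_fun_d.

End InducedBraidMap.

(** The blocks of a filtered homotopy form a chain homotopy over every convex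
    set. *)
Lemma filtered_homotopic_Hmap_id (disp : Order.disp_t)
    (P : finPOrderType disp) (K : fieldType) (C D : graded_complex P K)
    (f : chain_map C D) (g : chain_map D C)
    (filf : filtered_map f) (filg : filtered_map g) :
    @filtered_homotopic _ P K C C (fun n => g n \o f n) (fun n => \1) ->
  forall (I : convex_set P) n,
  Hmap (gres_map filg I) n \o Hmap (gres_map filf I) n = \1.
Proof.
case=> h [_ filh hE] I n.
have filbd := @gc_filtered _ _ _ C.
apply: (@Hmap_homotopic_id K (gb_cc C I) (gb_cc D I) (gres_map filf I)
  (gres_map filg I) n (gres I (h n (n + 1))) (gres I (h (n - 1) n))).
transitivity (gres I (g n \o f n - \1)).
  by rewrite gresB gres_id (gres_comp I (@filf n) (@filg n)).
by rewrite hE gresD !gres_comp.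
Qed.

Lemma filtered_equiv_homology_braid (disp : Order.disp_t)
    (P : finPOrderType disp) (K : fieldType) (C D : graded_complex P K) :
    filtered_chain_equivalent C D ->
  braid_isomorphic (homology_braid (complex_braid C))
                   (homology_braid (complex_braid D)).
Proof.
case=> f [g [filf filg gf fg]].
exists (homology_braid_map filf), (homology_braid_map filg) => I n.
by split; apply: filtered_homotopic_Hmap_id.
Qed.

Theorem theorem9p23 (dP : Order.disp_t) (P : finPOrderType dP) (K : fieldType)
    (dX : Order.disp_t) (X : finPOrderType dX)
    (XX : graded_cell_complex K P X) (C' : graded_complex P K) :
  conley_complex (cell_graded_complex XX) C' ->
  connection_matrix C' (homology_braid (cell_braid XX)).
Proof.
case=> strictC' equivC'; split=> //.
exact: filtered_equiv_homology_braid equivC'.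
Qed.
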